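(* Let $R$ be a commutative Noetherian local ring with maximal ideal $\mathfrak m$, and let $\mathfrak a$ be an ideal of $R$ with $\dim_R R/\mathfrak a=1$. Let $M$ be a finitely generated $R$-module and $X$ an arbitrary $R$-module. Then $\operatorname{Ass}_R(H^i_{\mathfrak a}(M,X))$ is finite for all $i$.
   Context: $H^i_{\mathfrak a}(M,X)=\varinjlim_{k}\operatorname{Ext}^i_R(M/\mathfrak a^kM,X)$ is the $i$-th generalized local cohomology module. *)

(* Defs.v *)
From HB Require Import structures.
From mathcomp Require Import all_boot all_algebra.
From mathcomp Require Import generic_quotient ring_quotient.
From mathcomp Require Import boolp classical_sets functions cardinality.
From mathcomp Require Import freeg.

Set Implicit Arguments.
Unset Strict Implicit.
Unset Printing Implicit Defensive.

Import GRing.Theory.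
Local Open Scope ring_scope.
Local Open Scope quotient_scope.

(* Modules over a commutative ring are left modules; ideals are submodules of
   R^o (submodClosed R^o), possibly improper. *)

Definition linear_of (R : pzRingType) (U V : lmodType R) (f : U -> V)
    (fl : linear f) : {linear U -> V} :=
  HB.pack f (GRing.isLinear.Build R U V *:%R f fl).

Section Submodules.
Variables (R : comNzRingType) (V : lmodType R).

Section Comprehension.
Variable P : V -> Prop.
Hypothesis P0 : P 0.
Hypothesis PD : forall a u v, P u -> P v -> P (a *: u + v).

Definition pred_of_prop : {pred V} := fun x => `[< P x >].

Lemma pred_of_prop_closed : submod_closed pred_of_prop.
Proof.
split; first exact/asboolP.
by move=> a u v /asboolP Pu /asboolP Pv; apply/asboolP/PD.
Qed.

HB.instance Definition _ :=
  GRing.isSubmodClosed.Build R V pred_of_prop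
    (GRing.submod_closed_semi pred_of_prop_closed).

Definition submod_of : submodClosed V := pred_of_prop.

Lemma submod_ofP x : reflect (P x) (x \in submod_of).
Proof. exact: asboolP. Qed.

End Comprehension.

Definition submod_full : submodClosed V :=
  @submod_of (fun=> True) I (fun _ _ _ _ _ => I).

Fact submod_zero_closed a (u v : V) : u = 0 -> v = 0 -> a *: u + v = 0.
Proof. by move=> -> ->; rewrite scaler0 addr0. Qed.

Definition submod_zero : submodClosed V :=
  submod_of (erefl (0 : V)) submod_zero_closed.

Section Span.
Variable G : set V.

Definition span_prop (x : V) : Prop :=
  exists2 s : seq (R * V), {in s, forall p, G p.2}
    & x = \sum_(p <- s) p.1 *: p.2.

Fact span0 : span_prop 0.
Proof. by exists [::]; rewrite ?big_nil. Qed.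

Fact spanD a u v : span_prop u -> span_prop v -> span_prop (a *: u + v).
Proof.
move=> [s sG ->] [t tG ->]; exists ([seq (a * p.1, p.2) | p <- s] ++ t).
  move=> p; rewrite mem_cat => /orP[/mapP[q /sG qG ->] //|/tG //].
rewrite big_cat big_map scaler_sumr /=; congr (_ + _).
by apply: eq_bigr => p _; rewrite scalerA.
Qed.

Definition submod_span : submodClosed V := submod_of span0 spanD.

Lemma span_gen : {in G, forall x, x \in submod_span}.
Proof.
move=> x /set_mem Gx; apply/submod_ofP; exists [:: (1, x)].
  by move=> p; rewrite inE => /eqP ->.
by rewrite big_seq1 scale1r.
Qed.

Lemma span_sub (S : submodClosed V) :
  (forall x, G x -> x \in S) -> {subset submod_span <= S}.
Proof.
move=> GS x /submod_ofP [s sG ->]; rewrite big_seq.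
by apply: rpred_sum => p /sG /GS pS; exact: rpredZ.
Qed.

End Span.

Definition fin_gen (S : {pred V}) : Prop :=
  exists s : seq V, S =i submod_span [set` s].

Definition ideal_mul (I : submodClosed R^o) (S : submodClosed V) :
    submodClosed V :=
  submod_span [set x | exists r y, [/\ r \in I, y \in S & x = (r : R) *: y]].

Lemma ideal_mul_sub (I : submodClosed R^o) (S : submodClosed V) :
  {subset ideal_mul I S <= S}.
Proof. by apply: span_sub => x [r [y [_ yS ->]]]; exact: rpredZ. Qed.

Lemma ideal_mulSl (I J : submodClosed R^o) (S : submodClosed V) :
  {subset I <= J} -> {subset ideal_mul I S <= ideal_mul J S}.
Proof.
move=> IJ; apply: span_sub => x [r [y [/IJ rJ yS ->]]].
by apply: span_gen; apply/mem_set; exists r, y.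
Qed.

Section SubModule.
Variable S : submodClosed V.

Definition submodule : Type := {x : V | x \in S}.

HB.instance Definition _ := [isSub of submodule for @sval V (fun x => x \in S)].
HB.instance Definition _ := [Choice of submodule by <:].
HB.instance Definition _ := [SubChoice_isSubLmodule of submodule by <:].

End SubModule.

Section Quotient.
Variable S : submodClosed V.

Definition pred_of_submod : {pred V} := fun x => x \in S.

HB.instance Definition _ :=
  GRing.isZmodClosed.Build V pred_of_submod
    (GRing.submod_closedB (submodClosedP S)).

Definition quotient_mod : Type := Quotient.quot pred_of_submod.

HB.instance Definition _ := GRing.Zmodule.on quotient_mod.
HB.instance Definition _ := EqQuotient.on quotient_mod.

Definition qrepr (x : quotient_mod) : V :=
  repr (x : Quotient.quot pred_of_submod).

Definition qproj_fun (x : V) : quotient_mod :=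
  \pi_(Quotient.quot pred_of_submod) x.

Lemma qreprK x : qproj_fun (qrepr x) = x.
Proof. exact: reprK. Qed.

Lemma qproj_funP x y : reflect (qproj_fun x = qproj_fun y) (x - y \in S).
Proof. by rewrite (Quotient.idealrBE pred_of_submod); exact: eqP. Qed.

Lemma qproj_funD x y : qproj_fun (x + y) = qproj_fun x + qproj_fun y.
Proof. exact: (raddfD \pi_(Quotient.quot pred_of_submod)). Qed.

Definition qscale (a : R) (x : quotient_mod) : quotient_mod :=
  qproj_fun (a *: qrepr x).

Lemma qproj_funZ a x : qproj_fun (a *: x) = qscale a (qproj_fun x).
Proof.
apply/qproj_funP; rewrite -scalerBr; apply: rpredZ.
by apply/qproj_funP; rewrite qreprK.
Qed.

Fact qscaleA a b x : qscale a (qscale b x) = qscale (a * b) x.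
Proof. by rewrite -(qreprK x) -!qproj_funZ scalerA. Qed.

Fact qscale1 : left_id 1 qscale.
Proof. by move=> x; rewrite -(qreprK x) -!qproj_funZ scale1r. Qed.

Fact qscaleDr : right_distributive qscale +%R.
Proof.
move=> a x y; rewrite -(qreprK x) -(qreprK y) -qproj_funD -!qproj_funZ.
by rewrite -qproj_funD scalerDr.
Qed.

Fact qscaleDl x : {morph qscale^~ x : a b / a + b}.
Proof.
by move=> a b; rewrite /= -(qreprK x) -!qproj_funZ scalerDl qproj_funD.
Qed.

HB.instance Definition _ :=
  GRing.Zmodule_isLmodule.Build R quotient_mod qscaleA qscale1 qscaleDr qscaleDl.

Fact qproj_linear : linear qproj_fun.
Proof. by move=> a x y; rewrite qproj_funD qproj_funZ. Qed.

Definition qproj : {linear V -> quotient_mod} := linear_of qproj_linear.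

Lemma qprojK x : qproj (qrepr x) = x.
Proof. exact: qreprK. Qed.

Lemma qproj_eq0 x : (qproj x == 0) = (x \in S).
Proof.
by rewrite -[x in RHS]subr0 -(linear0 qproj); apply/eqP/qproj_funP.
Qed.

End Quotient.
End Submodules.

Arguments qrepr {R V S}.
Arguments qproj {R V} S.

Section LinearMaps.
Variables (R : comNzRingType) (U V : lmodType R).

Section Induced.
Variables (f : {linear U -> V}) (S : submodClosed U) (T : submodClosed V).
Hypothesis fST : forall x, x \in S -> f x \in T.

Definition sub_map_fun (x : submodule S) : submodule T :=
  exist _ (f (val x)) (fST (valP x)).

Fact sub_map_linear : linear sub_map_fun.
Proof. by move=> a x y; apply: val_inj; rewrite /= linearP. Qed.

Definition sub_map : {linear submodule S -> submodule T} :=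
  linear_of sub_map_linear.

Definition quot_map_fun (x : quotient_mod S) : quotient_mod T :=
  qproj T (f (qrepr x)).

Lemma quot_map_funE x : quot_map_fun (qproj S x) = qproj T (f x).
Proof.
apply/qproj_funP; rewrite -linearB; apply/fST.
by apply/qproj_funP; rewrite qreprK.
Qed.

Fact quot_map_linear : linear quot_map_fun.
Proof.
move=> a x y; rewrite -(qprojK x) -(qprojK y) -linearP !quot_map_funE.
by rewrite -linearP -linearP.
Qed.

Definition quot_map : {linear quotient_mod S -> quotient_mod T} :=
  linear_of quot_map_linear.

End Induced.

Section KerIm.
Variable f : {linear U -> V}.

Fact ker_closed a u v : f u = 0 -> f v = 0 -> f (a *: u + v) = 0.
Proof. by move=> fu fv; rewrite linearP fu fv scaler0 addr0. Qed.

Definition lin_ker : submodClosed U := submod_of (linear0 f) ker_closed.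

Fact im_closed a u v :
  (exists x, u = f x) -> (exists x, v = f x) -> exists x, a *: u + v = f x.
Proof. by move=> [x ->] [y ->]; exists (a *: x + y); rewrite linearP. Qed.

Definition lin_im : submodClosed V :=
  @submod_of _ _ (fun y => exists x, y = f x)
    (ex_intro _ 0 (esym (linear0 f))) im_closed.

End KerIm.

Fact preim_closed (f : {linear U -> V}) (T : submodClosed V) a u v :
  f u \in T -> f v \in T -> f (a *: u + v) \in T.
Proof. by move=> fu fv; rewrite linearP rpredD ?rpredZ. Qed.

Fact preim0 (f : {linear U -> V}) (T : submodClosed V) : f 0 \in T.
Proof. by rewrite linear0 rpred0. Qed.

Definition submod_preim (f : {linear U -> V}) (T : submodClosed V) : submodClosed U :=
  submod_of (preim0 f T) (@preim_closed f T).

Fact hom0 : linear (0 : U -> V).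
Proof. by move=> a x y; rewrite scaler0 addr0. Qed.

Fact hom_closed a (f g : U -> V) : linear f -> linear g -> linear (a *: f + g).
Proof.
move=> fl gl b x y; rewrite addrfctE scalrfctE /= fl gl.
by rewrite !scalerDr !scalerA addrACA (mulrC a).
Qed.

Definition Hom : lmodType R := submodule (submod_of hom0 hom_closed).

Definition hom_fun (f : Hom) : U -> V := val f.

Lemma hom_funP (f : Hom) : linear (hom_fun f).
Proof. by have /submod_ofP := valP f. Qed.

Definition hom_of (f : U -> V) (fl : linear f) : Hom :=
  exist _ f (introT (submod_ofP hom0 hom_closed f) fl).

End LinearMaps.

Fact val_linear (R : comNzRingType) (V : lmodType R) (S : submodClosed V) :
  linear (val : submodule S -> V).
Proof. by []. Qed.

Definition incl (R : comNzRingType) (V : lmodType R) (S : submodClosed V) :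
  {linear submodule S -> V} := linear_of (@val_linear R V S).

Section Precomposition.
Variables (R : comNzRingType) (U V X : lmodType R) (f : {linear U -> V}).

Fact precomp_subproof (h : Hom V X) : linear (hom_fun h \o f).
Proof. by move=> a x y /=; rewrite linearP hom_funP. Qed.

Definition precomp_fun (h : Hom V X) : Hom U X := hom_of (precomp_subproof h).

Fact precomp_linear : linear precomp_fun.
Proof. by move=> a g h; apply: val_inj. Qed.

Definition precomp : {linear Hom V X -> Hom U X} := linear_of precomp_linear.

End Precomposition.

Section FreeModule.
Variable R : comNzRingType.

(* the free module on the underlying set of U *)
Definition free_mod (U : lmodType R) : lmodType R := {freeg U / R}.

Definition free_gen (U : lmodType R) (u : U) : free_mod U := Freeg [:: (1, u)].

Lemma free_sum (U : lmodType R) (D : free_mod U) :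
  D = \sum_(u <- dom D) coeff u D *: free_gen u.
Proof.
rewrite -[LHS]freeg_sumE; apply: eq_bigr => u _.
apply/eqP/freeg_eqP => v.
by rewrite coeffZ !coeffU mul1r.
Qed.

Fact fglift_linear (U V : lmodType R) (f : U -> V) :
  linear (fglift f : free_mod U -> V).
Proof.
pose lift : {additive free_mod U -> V} :=
  HB.pack (fglift f : free_mod U -> V) (GRing.isZmodMorphism.Build (free_mod U) V
    (fglift f : free_mod U -> V) (@lift_is_additive R U V f)).
have sumE (s : seq U) (F : U -> free_mod U) :
    fglift f (\sum_(u <- s) F u) = \sum_(u <- s) fglift f (F u).
  exact: (raddf_sum lift).
have liftE a D : fglift f (a *: D : free_mod U) = a *: fglift f D.
  rewrite -[in RHS](freeg_sumE D) -[a *: D]/(fgscale a D) /fgscale.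
  rewrite !sumE scaler_sumr.
  apply: eq_bigr => u _ /=.
  by rewrite !liftU scalerA.
by move=> a x y; rewrite -liftE; exact: (raddfD lift).
Qed.

Definition free_lift (U V : lmodType R) (f : U -> V) : {linear free_mod U -> V} :=
  linear_of (fglift_linear f).

Lemma free_lift_gen (U V : lmodType R) (f : U -> V) u :
  free_lift f (free_gen u) = f u.
Proof. by rewrite /= liftU scale1r. Qed.

Lemma free_ext (U V : lmodType R) (f g : {linear free_mod U -> V}) :
  (forall u, f (free_gen u) = g (free_gen u)) -> f =1 g.
Proof.
move=> fg D; rewrite (free_sum D) !linear_sum; apply: eq_bigr => u _.
by rewrite !linearZ fg.
Qed.

Definition free_map (U V : lmodType R) (f : {linear U -> V}) :
  {linear free_mod U -> free_mod V} := free_lift (fun u => free_gen (f u)).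

Definition aug (U : lmodType R) : {linear free_mod U -> U} := free_lift idfun.

Lemma aug_natural (U V : lmodType R) (f : {linear U -> V}) x :
  aug V (free_map f x) = f (aug U x).
Proof.
pose g : {linear free_mod U -> V} := aug V \o free_map f.
pose h : {linear free_mod U -> V} := f \o aug U.
apply: (@free_ext _ _ g h) => u.
by rewrite /g /h /= !liftU !scale1r liftU scale1r.
Qed.

Definition syz (U : lmodType R) : lmodType R := submodule (lin_ker (aug U)).

Fact syz_map_subproof (U V : lmodType R) (f : {linear U -> V}) x :
  x \in lin_ker (aug U) -> free_map f x \in lin_ker (aug V).
Proof.
move=> /submod_ofP xK; apply/submod_ofP.
by rewrite aug_natural xK linear0.
Qed.

Definition syz_map (U V : lmodType R) (f : {linear U -> V}) :
  {linear syz U -> syz V} := sub_map (syz_map_subproof f).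

End FreeModule.

Section Resolution.
Variable R : comNzRingType.

(* The functorial free resolution ... -> res 1 U -> res 0 U -> U, in which res n U
   is free on the underlying set of the n-th syzygy of U. Ext is computed from
   it; functoriality gives the transition maps without choosing lifts. *)
Fixpoint nsyz (n : nat) (U : lmodType R) : lmodType R :=
  if n is n'.+1 then syz (nsyz n' U) else U.

Fixpoint nsyz_map (n : nat) (U V : lmodType R) (f : {linear U -> V}) :
    {linear nsyz n U -> nsyz n V} :=
  if n is n'.+1 then syz_map (nsyz_map n' f) else f.

Definition res (n : nat) (U : lmodType R) : lmodType R := free_mod (nsyz n U).

Definition res_diff (n : nat) (U : lmodType R) :
    {linear res n.+1 U -> res n U} :=
  incl (lin_ker (aug (nsyz n U))) \o aug (nsyz n.+1 U).

Definition res_map (n : nat) (U V : lmodType R) (f : {linear U -> V}) :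
  {linear res n U -> res n V} := free_map (nsyz_map n f).

Lemma res_diff_natural n (U V : lmodType R) (f : {linear U -> V}) x :
  res_diff n V (res_map n.+1 f x) = res_map n f (res_diff n U x).
Proof. exact: (congr1 val (aug_natural (nsyz_map n.+1 f) x)). Qed.

End Resolution.

Section Ext.
Variable R : comNzRingType.

Definition cochain (n : nat) (U X : lmodType R) : lmodType R := Hom (res n U) X.

Definition cobound (n : nat) (U X : lmodType R) :
    {linear cochain n U X -> cochain n.+1 U X} := precomp X (res_diff n U).

Definition cocycles (n : nat) (U X : lmodType R) :
  submodClosed (cochain n U X) := lin_ker (cobound n U X).

Definition coboundaries (n : nat) (U X : lmodType R) :
    submodClosed (cochain n U X) :=
  if n is n'.+1 then lin_im (cobound n' U X) else submod_zero (cochain 0 U X).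

Definition ext_bounds (n : nat) (U X : lmodType R) :
    submodClosed (submodule (cocycles n U X)) :=
  submod_preim (incl (cocycles n U X)) (coboundaries n U X).

Definition Ext (n : nat) (U X : lmodType R) : lmodType R :=
  quotient_mod (ext_bounds n U X).

Section Functoriality.
Variables (U V X : lmodType R) (f : {linear U -> V}).

Definition cochain_map n : {linear cochain n V X -> cochain n U X} :=
  precomp X (res_map n f).

Lemma cobound_natural n h :
  cobound n U X (cochain_map n h) = cochain_map n.+1 (cobound n V X h).
Proof.
apply/val_inj/funext => x.
exact: (congr1 (hom_fun h) (esym (res_diff_natural f x))).
Qed.

Fact cocycles_map n h :
  h \in cocycles n V X -> cochain_map n h \in cocycles n U X.
Proof.
by move=> /submod_ofP hZ; apply/submod_ofP; rewrite cobound_natural hZ linear0.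
Qed.

Fact coboundaries_map n h :
  h \in coboundaries n V X -> cochain_map n h \in coboundaries n U X.
Proof.
case: n h => [|n] h /submod_ofP; first by move=> ->; rewrite linear0 rpred0.
by case=> g ->; apply/submod_ofP; exists (cochain_map n g);
  rewrite cobound_natural.
Qed.

Fact ext_bounds_map n h :
  h \in ext_bounds n V X -> sub_map (@cocycles_map n) h \in ext_bounds n U X.
Proof.
by move=> /submod_ofP hB; apply/submod_ofP; exact: coboundaries_map hB.
Qed.

Definition ext_map n : {linear Ext n V X -> Ext n U X} :=
  quot_map (@ext_bounds_map n).

End Functoriality.
End Ext.

Section DirectLimit.
Variables (R : comNzRingType) (E : nat -> lmodType R).
Variable phi : forall k, {linear E k -> E k.+1}.

Definition dprod : Type := forall k, E k.

HB.instance Definition _ := gen_eqMixin dprod.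
HB.instance Definition _ := gen_choiceMixin dprod.

Definition dprod_zero : dprod := fun k => 0.
Definition dprod_opp (x : dprod) : dprod := fun k => - x k.
Definition dprod_add (x y : dprod) : dprod := fun k => x k + y k.
Definition dprod_scale (a : R) (x : dprod) : dprod := fun k => a *: x k.

Fact dprod_addA : associative dprod_add.
Proof. by move=> x y z; apply: functional_extensionality_dep => k; exact: addrA. Qed.
Fact dprod_addC : commutative dprod_add.
Proof. by move=> x y; apply: functional_extensionality_dep => k; exact: addrC. Qed.
Fact dprod_add0 : left_id dprod_zero dprod_add.
Proof. by move=> x; apply: functional_extensionality_dep => k; exact: add0r. Qed.
Fact dprod_addN : left_inverse dprod_zero dprod_opp dprod_add.
Proof. by move=> x; apply: functional_extensionality_dep => k; exact: addNr. Qed.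

HB.instance Definition _ :=
  GRing.isZmodule.Build dprod dprod_addA dprod_addC dprod_add0 dprod_addN.

Fact dprod_scaleA a b x :
  dprod_scale a (dprod_scale b x) = dprod_scale (a * b) x.
Proof. by apply: functional_extensionality_dep => k; exact: scalerA. Qed.
Fact dprod_scale1 : left_id 1 dprod_scale.
Proof. by move=> x; apply: functional_extensionality_dep => k; exact: scale1r. Qed.
Fact dprod_scaleDr : right_distributive dprod_scale +%R.
Proof. by move=> a x y; apply: functional_extensionality_dep => k; exact: scalerDr. Qed.
Fact dprod_scaleDl x : {morph dprod_scale^~ x : a b / a + b}.
Proof. by move=> a b; apply: functional_extensionality_dep => k; exact: scalerDl. Qed.

HB.instance Definition _ := GRing.Zmodule_isLmodule.Build R dprod
  dprod_scaleA dprod_scale1 dprod_scaleDr dprod_scaleDl.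

Definition fin_supp (x : dprod) : Prop :=
  exists N : nat, forall k, (N <= k)%N -> x k = 0.

Fact fin_supp0 : fin_supp 0.
Proof. by exists 0%N. Qed.

Fact fin_suppD a x y : fin_supp x -> fin_supp y -> fin_supp (a *: x + y).
Proof.
move=> [m xm] [n yn]; exists (maxn m n) => k; rewrite geq_max => /andP[mk nk].
by rewrite -[LHS]/(a *: x k + y k) xm // yn // scaler0 addr0.
Qed.

Definition dsum : lmodType R := submodule (submod_of fin_supp0 fin_suppD).

Fact dsum_in_subproof k (x : E k) :
  (dfwith (fun j => 0 : E j) x : dprod) \in submod_of fin_supp0 fin_suppD.
Proof.
apply/submod_ofP; exists k.+1 => j kj; apply: dfwith_out.
by rewrite neq_ltn kj.
Qed.

Definition dsum_in k (x : E k) : dsum :=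
  exist _ (dfwith (fun j => 0 : E j) x : dprod) (dsum_in_subproof x).

(* the colimit of E 0 -> E 1 -> ... is the quotient of the direct sum that
   identifies every x in E k with phi k x *)
Definition dirlim_rel : submodClosed dsum :=
  submod_span [set z | exists k (x : E k), z = dsum_in x - dsum_in (phi k x)].

Definition dirlim : lmodType R := quotient_mod dirlim_rel.

End DirectLimit.

Section GeneralizedLocalCohomology.
Variable R : comNzRingType.

Fixpoint ideal_pow (a : submodClosed R^o) (k : nat) : submodClosed R^o :=
  if k is k'.+1 then ideal_mul a (ideal_pow a k') else submod_full R^o.

Variables (a : submodClosed R^o) (M X : lmodType R).

Definition pow_mul (k : nat) : submodClosed M :=
  ideal_mul (ideal_pow a k) (submod_full M).

Fact pow_mul_le k x : x \in pow_mul k.+1 -> idfun x \in pow_mul k.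
Proof. by apply: ideal_mulSl; exact: ideal_mul_sub. Qed.

Definition pow_proj (k : nat) :
    {linear quotient_mod (pow_mul k.+1) -> quotient_mod (pow_mul k)} :=
  quot_map (@pow_mul_le k).

(* transition maps are induced contravariantly by M/a^(k+1)M -> M/a^k M;
   starting at k = 0 (where M/a^0 M = 0) does not affect the colimit *)
Definition gen_loc_coh (i : nat) : lmodType R :=
  dirlim (fun k => ext_map X (pow_proj k) i).

End GeneralizedLocalCohomology.

Section CommutativeAlgebra.
Variable R : comNzRingType.

Definition is_noetherian : Prop :=
  forall I : submodClosed R^o, @fin_gen R R^o I.

(* idealr_closed only holds for proper ideals *)
Definition is_prime (p : {pred R}) : Prop :=
  idealr_closed p /\ prime_idealr_closed p.

Definition is_maximal (m : {pred R}) : Prop :=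
  idealr_closed m /\
  forall J : {pred R}, idealr_closed J -> {subset m <= J} -> J =i m.

Definition is_local_with (m : {pred R}) : Prop :=
  is_maximal m /\ forall n : {pred R}, is_maximal n -> n =i m.

Variable V : lmodType R.

Definition ann (v : V) : {pred R} := fun r => r *: v == 0.

Definition Ass : set {pred R} :=
  [set p | is_prime p /\ exists v : V, p =i ann v].

(* the localization V_p is nonzero iff v / 1 <> 0 in V_p for some v, that is,
   iff no element outside p kills v *)
Definition Supp : set {pred R} :=
  [set p | is_prime p /\ exists v : V, forall s, s \notin p -> s *: v != 0].

Definition supp_chain (n : nat) : Prop :=
  exists p : nat -> {pred R},
    (forall i, (i <= n)%N -> Supp (p i)) /\
    (forall i, (i < n)%N ->
       {subset p i <= p i.+1} /\ ~ {subset p i.+1 <= p i}).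

(* dim V = d, for the Krull dimension (supremum of the lengths of the chains of
   primes in the support) *)
Definition has_dim (d : nat) : Prop :=
  supp_chain d /\ forall n, supp_chain n -> (n <= d)%N.

End CommutativeAlgebra.

(* Main.v *)
Require Import Defs.
From mathcomp Require Import all_boot all_algebra.
From mathcomp Require Import boolp classical_sets cardinality.

Set Implicit Arguments.
Unset Strict Implicit.
Unset Printing Implicit Defensive.

Import GRing.Theory.
Local Open Scope ring_scope.

(** If [r] kills [U] then [r] kills every [Ext n U X]. Hence [Ext n (M/a^k M) X]
    is killed by [a^k]; as an element of the colimit is represented by finitely
    many classes, it is killed by [r ^+ N] for all [r] in [a] and one [N]. A
    prime that is the annihilator of an element of the local cohomology
    therefore contains [a] ([gen_loc_coh_torsion], [prime_exp]), and it is
    enough to prove that only finitely many primes contain [a].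

    By Noetherian induction, every prime containing [a] contains a member of
    some finite set [L] of such primes ([finite_prime_cover]). If [q] contains
    [a] and is neither in [L] nor maximal, then [p < q < m] for some [p] in [L],
    which is a chain of length 2 in the support of [R/a], against [dim R/a = 1]
    ([finite_primes_above]).

    The first claim is not immediate on the resolution used to define [Ext]:
    multiplication by [r] on [U] does not induce multiplication by [r] on the
    free module over the set [U], because [r *: free_gen u] and
    [free_gen (r *: u)] differ. The zero map and multiplication by [r] are
    both lifts of [0 = r : U -> U] to the resolution, and what is built is the
    contracting homotopy between them ([syz_retract], [syz_retract_syz]).
    Applied to a cocycle it exhibits [r] times that cocycle as a coboundary
    ([cocycle_scale_coboundary]). *)

(** * Annihilators of Ext *)

Section ExtAnnihilation.
Variable R : comNzRingType.
Implicit Types (U V W X : lmodType R) (r : R).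

(** One degree of the contracting homotopy: multiplication by [r] on the syzygy
    module extends to the whole free module. A map on the syzygy module that so
    extends becomes a coboundary, hence [r] kills the first Ext group of [V]. *)
Definition syz_retract r V : Prop :=
  exists t : {linear free_mod V -> syz V}, forall x : syz V, t (val x) = r *: x.

(** The retraction is multiplication by [r] itself, whose values lie in the
    kernel of the augmentation. *)
Lemma syz_retract_of_killed r V :
  (forall v : V, r *: v = 0) -> syz_retract r V.
Proof.
move=> rV0.
have ry_syz (y : free_mod V) : r *: y \in lin_ker (aug V).
  by apply/submod_ofP; rewrite linearZ; exact: rV0.
pose f (y : free_mod V) : syz V := exist _ (r *: y) (ry_syz y).
have f_lin : linear f.
  move=> b x y; apply: val_inj => /=.
  by rewrite scalerDr !scalerA (mulrC r).
by exists (linear_of f_lin) => x; apply: val_inj.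
Qed.

(** A lift of [t] through the surjection [aug W], possible since the source is
    free. *)
Definition free_factor V W (t : {linear free_mod V -> W}) :
    {linear free_mod V -> free_mod W} :=
  free_lift (fun v : V => free_gen (t (free_gen v))).

Lemma aug_free_factor V W (t : {linear free_mod V -> W}) y :
  aug W (free_factor t y) = t y.
Proof.
pose g : {linear free_mod V -> W} := aug W \o free_factor t.
apply: (@free_ext _ _ _ g t) => v.
by rewrite -[LHS]/(aug W (free_factor t (free_gen v))) !free_lift_gen.
Qed.

(** The inductive step of the homotopy: [r - t~ d], with [t~] a lift of the
    previous retraction [t] through [aug (syz V)], takes values in the next
    syzygy because [t] is multiplication by [r] on [syz V], and it is
    multiplication by [r] on [syz (syz V)] because [d] vanishes there. *)
Lemma syz_retract_syz r V : syz_retract r V -> syz_retract r (syz V).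
Proof.
move=> [t tE].
pose d : {linear free_mod (syz V) -> free_mod V} :=
  incl (lin_ker (aug V)) \o aug (syz V).
pose f (y : free_mod (syz V)) := r *: y - free_factor t (d y).
have f_syz y : f y \in lin_ker (aug (syz V)).
  by apply/submod_ofP; rewrite linearB linearZ aug_free_factor tE; exact: subrr.
have f_lin : linear (fun y => exist _ (f y) (f_syz y) : syz (syz V)).
  move=> b x y; apply: val_inj; rewrite -[LHS]/(f (b *: x + y)).
  rewrite -[RHS]/(b *: f x + f y) /f (linearP d) (linearP (free_factor t)).
  by rewrite scalerBr scalerDr !scalerA (mulrC r) opprD addrACA.
exists (linear_of f_lin) => x; apply: val_inj.
rewrite -[LHS]/(f (val x)) -[RHS]/(r *: val x) /f.
have /submod_ofP x0 := valP x.
by rewrite -[d _]/(val (aug (syz V) (val x))) x0 linear0 subr0.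
Qed.

Lemma syz_retract_nsyz r U n :
  (forall u : U, r *: u = 0) -> syz_retract r (nsyz n U).
Proof.
move=> rU0; elim: n => [|n IHn]; first exact: syz_retract_of_killed.
exact: syz_retract_syz.
Qed.

(** The differential maps onto the kernel of the augmentation, so a cocycle in
    degree [n] factors through the [n]-th syzygy. *)
Lemma cocycle_aug0 n U X (h : cochain n U X) (y : res n U) :
  h \in cocycles n U X -> aug (nsyz n U) y = 0 -> hom_fun h y = 0.
Proof.
move=> /submod_ofP hZ y0.
have y_syz : y \in lin_ker (aug (nsyz n U)) by apply/submod_ofP.
pose z : syz (nsyz n U) := exist _ y y_syz.
have <- : res_diff n U (free_gen z) = y.
  exact: (congr1 val (free_lift_gen idfun z)).
exact: (congr1 (fun g : cochain n.+1 U X => hom_fun g (free_gen z)) hZ).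
Qed.

Definition hom_linear U V (h : Defs.Hom U V) : {linear U -> V} :=
  linear_of (hom_funP h).

(** In positive degree, [r *: h] is the coboundary of [h \o free_factor t]: the
    maps [free_factor t \o d] and [r] agree after augmentation, hence also after
    [h]. In degree zero [aug] already kills [r *: y], so [r *: h = 0]. *)
Lemma cocycle_scale_coboundary r n U X (h : cochain n U X) :
  (forall u : U, r *: u = 0) -> h \in cocycles n U X ->
  r *: h \in coboundaries n U X.
Proof.
move=> rU0 hZ.
have h0 y : aug (nsyz n U) y = 0 -> hom_linear h y = 0 by exact: cocycle_aug0.
case: n h hZ h0 => [|n] h hZ h0; apply/submod_ofP.
  apply: val_inj; apply: funext => y.
  rewrite -[LHS]/(r *: hom_linear h y) -linearZ h0 // linearZ.
  exact: rU0.
have [t tE] := syz_retract_nsyz n rU0.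
pose g : {linear res n U -> X} := hom_linear h \o free_factor t.
have g_lin : linear g by exact: linearP.
exists (hom_of g_lin); apply: val_inj; apply: funext => y.
rewrite -[LHS]/(r *: hom_linear h y) -[RHS]/(g (res_diff n U y)) -linearZ.
apply/eqP; rewrite -subr_eq0 /g /comp -linearB h0 //.
by rewrite linearB aug_free_factor [t _]tE linearZ subrr.
Qed.

Lemma ext_scale0 r n U X :
  (forall u : U, r *: u = 0) -> forall e : Ext n U X, r *: e = 0.
Proof.
move=> rU0 e; rewrite -(qprojK e) -linearZ; apply/eqP; rewrite qproj_eq0.
apply/submod_ofP.
exact: cocycle_scale_coboundary rU0 (valP (qrepr e)).
Qed.

End ExtAnnihilation.

(** * Torsion of generalized local cohomology *)

Section Torsion.
Variables (R : comNzRingType) (a : submodClosed R^o) (M X : lmodType R).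

Lemma mem_ideal_pow (r : R) k : r \in a -> (r ^+ k : R^o) \in ideal_pow a k.
Proof.
move=> ra; elim: k => [|k IHk]; first exact/submod_ofP.
by rewrite exprS; apply: span_gen; apply/mem_set; exists r, (r ^+ k).
Qed.

Lemma pow_scale_quotient (r : R) k N (u : quotient_mod (pow_mul a M k)) :
  r \in a -> (k <= N)%N -> r ^+ N *: u = 0.
Proof.
move=> ra kN; rewrite -(subnK kN) exprD -scalerA.
suff -> : r ^+ k *: u = 0 by rewrite scaler0.
rewrite -(qprojK u) -linearZ; apply/eqP.
rewrite qproj_eq0; apply: span_gen; apply/mem_set.
by exists (r ^+ k), (qrepr u); split => //; [exact: mem_ideal_pow|exact/submod_ofP].
Qed.

(** One exponent serves all components of a representative in the direct sum: a
    bound on its support works, since [r ^+ N] kills the components of index at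
    most [N] and the others vanish. *)
Lemma gen_loc_coh_torsion i (v : gen_loc_coh a M X i) :
  exists N : nat, forall r : R, r \in a -> r ^+ N *: v = 0.
Proof.
have /submod_ofP[N zN] := valP (qrepr v); exists N => r ra.
rewrite -(qprojK v) -linearZ.
suff -> : r ^+ N *: qrepr v = 0 by rewrite linear0.
apply: val_inj; apply: functional_extensionality_dep => k.
rewrite -[LHS]/(r ^+ N *: val (qrepr v) k) -[RHS]/(0 : Ext i _ X).
have [Nk|/ltnW kN] := leqP N k; first by rewrite zN // scaler0.
by apply: ext_scale0 => u; exact: pow_scale_quotient.
Qed.

End Torsion.

(** * Primes containing an ideal of a Noetherian ring *)

Section Ideals.
Variable R : comNzRingType.
Implicit Types (I J : submodClosed R^o) (p q n : {pred R}) (x : R).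

Lemma ideal_mulr I (r x : R) : x \in I -> r * x \in I.
Proof. exact: (@rpredZ R R^o I r x). Qed.

Lemma ideal0 I : (0 : R) \in I.
Proof. exact: (@rpred0 R^o I). Qed.

Lemma idealD I (r s x y : R) : x \in I -> y \in I -> r * x + s * y \in I.
Proof. by move=> xI yI; apply: (@rpredD R^o I); exact: ideal_mulr. Qed.

(** The definitions of primes and maximal ideals speak of predicates, Noetherian
    induction of submodules; [ideal_pred] and [ideal_of] pass between them. *)
Definition ideal_pred I : {pred R} := fun x => x \in I.

Section OfPred.
Variable p : {pred R}.
Hypothesis p_ideal : idealr_closed p.

Fact ideal_of_closed (r u v : R^o) : u \in p -> v \in p -> r *: u + v \in p.
Proof. by case: p_ideal => _ _; apply. Qed.

Fact ideal_of0 : (0 : R^o) \in p.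
Proof. by case: p_ideal. Qed.

Definition ideal_of : submodClosed R^o := submod_of ideal_of0 ideal_of_closed.

Lemma mem_ideal_of x : (x \in ideal_of) = (x \in p).
Proof. exact: asboolb. Qed.

End OfPred.

Section Adjoin.
Variables (I : submodClosed R^o) (x : R).

Definition adjoin_prop (z : R^o) : Prop :=
  exists r u : R, u \in I /\ z = u + r * x.

Fact adjoin0 : adjoin_prop 0.
Proof. by exists 0, 0; rewrite ideal0 mul0r addr0. Qed.

Fact adjoinD (b u v : R^o) :
  adjoin_prop u -> adjoin_prop v -> adjoin_prop (b *: u + v).
Proof.
move=> [r [y [yI ->]]] [s [z [zI ->]]].
exists (b * r + s), (b * y + z); split.
  by rewrite -[z]mul1r; exact: idealD.
by rewrite mulrDl [b *: _]mulrDr mulrA addrACA.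
Qed.

Definition adjoin : submodClosed R^o := submod_of adjoin0 adjoinD.

Lemma adjoinP (z : R) : reflect (adjoin_prop z) (z \in adjoin).
Proof. exact: asboolP. Qed.

Lemma sub_adjoin : {subset I <= adjoin}.
Proof. by move=> u uI; apply/adjoinP; exists 0, u; rewrite mul0r addr0. Qed.

Lemma mem_adjoin : x \in adjoin.
Proof. by apply/adjoinP; exists 1, 0; rewrite ideal0 mul1r add0r. Qed.

Lemma adjoin_sub (p : {pred R}) :
  idealr_closed p -> {subset I <= p} -> x \in p -> {subset adjoin <= p}.
Proof.
move=> p_ideal Ip xp z /adjoinP[r [u [/Ip up ->]]].
by case: p_ideal => _ _ pD; rewrite addrC; exact: pD.
Qed.

End Adjoin.

Lemma idealr_closed_of I : (1 : R) \notin I -> idealr_closed (ideal_pred I).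
Proof.
move=> I1; split => //; first exact: ideal0.
by move=> b u v uI vI; rewrite -[v]mul1r; exact: idealD.
Qed.

(** A counterexample to [P] always has a strictly larger counterexample; the
    union of the resulting ascending chain is finitely generated, so the chain
    is stationary from some stage on, a contradiction. *)
Lemma noetherian_ind (P : submodClosed R^o -> Prop) :
  is_noetherian R ->
  (forall I, (forall J, {subset I <= J} -> ~ {subset J <= I} -> P J) -> P I) ->
  forall I, P I.
Proof.
move=> noeth Pind I0; apply: contrapT => nPI0.
pose bad := {I | ~ P I}.
have larger (b : bad) : exists c : bad,
    {subset sval b <= sval c} /\ ~ {subset sval c <= sval b}.
  case: b => I nPI; apply: contrapT => no_larger.
  apply: (nPI); apply: Pind => J IJ nJI; apply: contrapT => nPJ.
  by apply: no_larger; exists (exist _ J nPJ).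
have [step stepP] := choice larger.
pose c k : submodClosed R^o := sval (iter k step (exist _ I0 nPI0)).
have c_mono j k : (j <= k)%N -> {subset c j <= c k}.
  move=> /subnK <-; elim: (k - j)%N => [//|d IHd] y /IHd.
  by case: (stepP (iter (d + j) step (exist _ I0 nPI0))) => + _; apply.
pose U (y : R^o) := exists k, y \in c k.
have U0 : U 0 by exists 0%N; rewrite rpred0.
have UD (b : R) (u v : R^o) : U u -> U v -> U (b *: u + v).
  move=> [j uj] [k vk]; exists (maxn j k).
  by rewrite rpredD ?rpredZ //; [exact: c_mono (leq_maxl _ _) _ uj|
    exact: c_mono (leq_maxr _ _) _ vk].
have [s sE] := noeth (submod_of U0 UD).
have [N sN] : exists N, {in s, forall y, y \in c N}.
  have : {in s, forall y, U y}.
    move=> y ys; apply/(submod_ofP U0 UD); rewrite sE; apply: span_gen.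
    exact/mem_set.
  elim: s {sE} => [|y s IHs] sU; first by exists 0%N.
  have [j yj] := sU y (mem_head _ _).
  have [k sk] : exists N, {in s, forall z, z \in c N}.
    by apply: IHs => z zs; apply: sU; rewrite inE zs orbT.
  exists (maxn j k) => z; rewrite inE => /predU1P[->|/sk zk].
    exact: c_mono (leq_maxl _ _) _ yj.
  exact: c_mono (leq_maxr _ _) _ zk.
case: (stepP (iter N step (exist _ I0 nPI0))) => _; apply => y ySN.
apply: (@span_sub _ _ [set` s]); first by move=> z; exact: sN.
by rewrite -sE; apply/submod_ofP; exists N.+1.
Qed.

Lemma maximal_above I : is_noetherian R -> (1 : R) \notin I ->
  exists2 n : {pred R}, is_maximal n & {subset I <= n}.
Proof.
move=> noeth; move: I; apply: (noetherian_ind noeth) => I IH I1.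
have [I_max|I_nmax] := pselect (is_maximal (ideal_pred I)).
  by exists (ideal_pred I).
have [J [J_ideal IJ nJI]] : exists J : {pred R},
    [/\ idealr_closed J, {subset I <= J} & ~ {subset J <= I}].
  apply: contrapT => no_J; apply: I_nmax.
  split; first exact: idealr_closed_of.
  move=> J J_ideal IJ y; apply/idP/idP; last exact: IJ.
  move: y; apply: contrapT => nJI; apply: no_J; by exists J.
have [|||n n_max Jn] := IH (ideal_of J_ideal).
- by move=> y /IJ; rewrite mem_ideal_of.
- by move=> JI; apply: nJI => y yJ; apply: JI; rewrite mem_ideal_of.
- by rewrite mem_ideal_of; case: J_ideal.
by exists n => // y /IJ yJ; apply: Jn; rewrite mem_ideal_of.
Qed.

Lemma maximal_prime n : is_maximal n -> is_prime n.
Proof.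
move=> [n_ideal n_max]; split => // x y xyn.
have [n0 _ nD] := n_ideal.
apply/orP; case: (boolP (x \in n)) => [|xNn]; [by left|right].
pose J := adjoin (ideal_of n_ideal) x.
have nJ : {subset n <= J} by move=> z zn; apply: sub_adjoin; rewrite mem_ideal_of.
have : 1 \in J.
  apply: contraNT xNn => J1.
  by rewrite -(n_max (ideal_pred J) (idealr_closed_of J1) nJ); exact: mem_adjoin.
move=> /adjoinP[r [u [un uE]]].
rewrite mem_ideal_of in un.
rewrite -[y]mul1r uE mulrDl mulrC -mulrA; apply: (nD) => //.
by rewrite -[r * _]addr0; exact: nD.
Qed.

(** This is the finiteness of the set of minimal primes over [I], in a form that
    does not require the existence of minimal primes. If [x * y] is in [I], a
    prime above [I] contains [I + (x)] or [I + (y)]; so for [I] neither prime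
    nor improper the union of covers of two strictly larger ideals works. *)
Lemma finite_prime_cover I : is_noetherian R ->
  exists L : set {pred R}, [/\ finite_set L,
    forall p, L p -> is_prime p /\ {subset I <= p} &
    forall q, is_prime q -> {subset I <= q} -> exists2 p, L p & {subset p <= q}].
Proof.
move=> noeth; move: I; apply: (noetherian_ind noeth) => I IH.
case: (boolP (1 \in I)) => [I1|I1].
  exists set0; split => // q [[_ q1 _] _] Iq.
  by move: q1; rewrite Iq.
have I_ideal := idealr_closed_of I1.
have [I_prime|I_nprime] := pselect (is_prime (ideal_pred I)).
  exists [set ideal_pred I]%classic; split; first exact: finite_set1.
    by move=> p ->; split.
  by move=> q _ Iq; exists (ideal_pred I).
have [x [y [xyI xI yI]]] :
    exists x y, [/\ x * y \in I, x \notin I & y \notin I].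
  apply: contrapT => no_xy; apply: I_nprime; split => // x y xyI.
  apply: contrapT => /negP; rewrite negb_or => /andP[xI yI].
  by apply: no_xy; exists x, y.
have cover z : z \notin I -> exists L : set {pred R}, [/\ finite_set L,
    forall p, L p -> is_prime p /\ {subset I <= p} &
    forall q, is_prime q -> {subset adjoin I z <= q} ->
      exists2 p, L p & {subset p <= q}].
  move=> zI; have [||L [L_fin Lp Lq]] := IH (adjoin I z).
  - exact: sub_adjoin.
  - by move=> /(_ _ (mem_adjoin I z)); apply/negP.
  exists L; split => // p /Lp[p_prime Ip]; split => // w wI.
  exact/Ip/sub_adjoin.
have [Lx [Lx_fin Lxp Lxq]] := cover x xI.
have [Ly [Ly_fin Lyp Lyq]] := cover y yI.
exists (Lx `|` Ly)%classic; split; first by rewrite finite_setU.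
  by move=> p [/Lxp|/Lyp].
move=> q q_prime Iq.
have [q_ideal q_mul] := q_prime.
have /orP[xq|yq] := q_mul _ _ (Iq _ xyI).
  have [p Lp pq] := Lxq q q_prime (adjoin_sub q_ideal Iq xq).
  by exists p => //; left.
have [p Lp pq] := Lyq q q_prime (adjoin_sub q_ideal Iq yq).
by exists p => //; right.
Qed.

(** The class of 1 has annihilator [I], so it survives localization at any prime
    above [I]. *)
Lemma Supp_quotient I p :
  is_prime p -> {subset I <= p} -> Supp (quotient_mod I) p.
Proof.
move=> p_prime Ip; split => //; exists (qproj I (1 : R^o)) => s sp.
by rewrite -linearZ qproj_eq0 [_ *: _]mulr1; apply: contra sp; exact: Ip.
Qed.

Lemma finite_primes_above (m : {pred R}) I :
  is_noetherian R -> is_local_with m -> has_dim (quotient_mod I) 1 ->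
  finite_set [set p : {pred R} | is_prime p /\ {subset I <= p}]%classic.
Proof.
move=> noeth [m_max m_uniq] [_ dim1].
have sub_m p : is_prime p -> {subset p <= m}.
  move=> [p_ideal _]; have p1 : 1 \notin ideal_of p_ideal.
    by rewrite mem_ideal_of; case: p_ideal.
  have [n /m_uniq nm pn] := maximal_above noeth p1.
  by move=> x xp; rewrite -nm; apply: pn; rewrite mem_ideal_of.
have [L [L_fin Lp Lq]] := finite_prime_cover I noeth.
apply: (@sub_finite_set _ _ (L `|` [set m])%classic); last first.
  by rewrite finite_setU; split => //; exact: finite_set1.
move=> q [q_prime Iq].
have [p pL pq] := Lq q q_prime Iq; have [p_prime Ip] := Lp p pL.
have [qp|nqp] := pselect {subset q <= p}.
  left; suff -> : q = p by [].
  by apply: funext => x; apply/idP/idP; [exact: qp|exact: pq].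
have [mq|nmq] := pselect {subset m <= q}.
  right; apply: funext => x; apply/idP/idP; [exact: sub_m|exact: mq].
(* Otherwise p < q < m is a chain of primes that is too long. *)
suff /dim1 : supp_chain (quotient_mod I) 2 by [].
exists (fun k => nth m [:: p; q] k); split.
  move=> [|[|[|//]]] _ /=; apply: Supp_quotient => //.
    exact: maximal_prime.
  by move=> x /Iq; exact: sub_m.
by move=> [|[|//]] _ /=; split => //; exact: sub_m.
Qed.

Lemma prime_exp p x N : is_prime p -> x ^+ N \in p -> x \in p.
Proof.
move=> [[_ p1 _] p_mul]; elim: N => [|N IHN]; first by rewrite expr0 (negPf p1).
by rewrite exprS => /p_mul/orP[|/IHN].
Qed.

End Ideals.

Theorem corollary3p14 (R : comNzRingType) (m : {pred R})
    (a : submodClosed R^o) (M X : lmodType R) :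
  is_noetherian R ->
  is_local_with m ->
  has_dim (quotient_mod a) 1 ->
  fin_gen (submod_full M) ->
  forall i : nat, finite_set (Ass (gen_loc_coh a M X i)).
Proof.
move=> noeth m_local dim1 _ i.
apply: sub_finite_set (finite_primes_above noeth m_local dim1).
move=> p [p_prime [v pE]]; split => // r ra.
have [N rN] := gen_loc_coh_torsion v.
apply: (prime_exp (N := N) p_prime).
by rewrite pE unfold_in /ann rN.
Qed.
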